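(* Let $\Omega\subseteq\mathbb{R}^n$ be a nonempty bounded open set, and let $\nu\neq0$ be a symmetric L\'evy measure on $\mathbb{R}^n$. Then there exists a constant $C(\nu,\Omega)$, depending only on $\nu$ and $\Omega$, such that $$\|u\|_{L^2(\Omega)}^2\le C(\nu,\Omega)\,\langle u,u\rangle_\nu\qquad\text{for every }u\in H_\nu^{\Omega}(\mathbb{R}^n).$$
   Context: All functions are real-valued. A symmetric L\'evy measure is a nonnegative Borel measure $\nu$ on $\mathbb{R}^n$ with $\nu(\{0\})=0$, $\nu(-A)=\nu(A)$ for every Borel $A$, and $\int_{\mathbb{R}^n}(1\wedge|y|^2)\,d\nu(y)<\infty$ (it need not be absolutely continuous). For $x\in\mathbb{R}^n$, $\nu_x(A)=\nu(A-x)$. $H_\nu^{\Omega}(\mathbb{R}^n)$ is the space of Borel measurable functions $u$ on $\mathbb{R}^n$ (identified if equal a.e.) such that $u=0$ a.e. in $\mathbb{R}^n\setminus\Omega$ and $$\|u\|_{L^2(\Omega)}^2+\frac12\int_\Omega\int_{\mathbb{R}^n}(u(x)-u(y))^2\,d\nu_y(x)\,dy<\infty.$$ Furthermore $\langle u,u\rangle_\nu=\frac12\int_{\mathbb{R}^n}\int_{\mathbb{R}^n}(u(x)-u(y))^2\,d\nu_y(x)\,dy=\frac12\int_{\mathbb{R}^n}\int_{\mathbb{R}^n}(u(y)-u(x+y))^2\,d\nu(x)\,dy$. *)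

(* Defs.v *)
From HB Require Import structures.
From mathcomp Require Import all_boot all_order all_algebra.
From mathcomp Require Import all_classical all_reals all_analysis.
From mathcomp Require Import measurable_realfun.

Set Implicit Arguments.
Unset Strict Implicit.
Unset Printing Implicit Defensive.

Import Order.TTheory GRing.Theory Num.Theory.
Import numFieldNormedType.Exports.

Local Open Scope classical_set_scope.
Local Open Scope ring_scope.

Definition rV_borel_display : measure_display.
Proof. exact: default_measure_display. Qed.

Section rV_borel.
Context (R : realType) (n : nat).

Definition rV_borel : set (set 'rV[R]_n) := <<s @open 'rV[R]_n >>.

Let rV_borelC (A : set 'rV[R]_n) : rV_borel A -> rV_borel (~` A).
Proof. exact: sigma_algebraC. Qed.

HB.instance Definition _ := @isMeasurable.Build rV_borel_display 'rV[R]_n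
  rV_borel (@sigma_algebra0 _ _ _) rV_borelC (@sigma_algebra_bigcup _ _ _).

Lemma open_measurable_rV (A : set 'rV[R]_n) : open A -> measurable A.
Proof. exact: sub_sigma_algebra. Qed.

End rV_borel.

Lemma measurable_fun_rV d (T : measurableType d) (R : realType) (n : nat)
    (f : T -> 'rV[R]_n) :
  (forall A, open A -> measurable (f @^-1` A)) -> measurable_fun setT f.
Proof.
move=> fo; apply: (measurability (@open 'rV[R]_n)) => // _ [A oA <-].
by rewrite setTI; exact: fo.
Qed.

Lemma continuous_measurable_rV (R : realType) (m n : nat)
    (f : 'rV[R]_m -> 'rV[R]_n) : continuous f -> measurable_fun setT f.
Proof.
move=> /continuousP cf; apply: measurable_fun_rV => A oA.
by apply: open_measurable_rV; exact: cf.
Qed.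

Lemma continuous_measurable_rVR (R : realType) (m : nat)
    (f : 'rV[R]_m -> R) : continuous f -> measurable_fun setT f.
Proof.
move=> /continuousP cf.
apply: (measurability _ (RGenOpens.measurableE R)) => // _ [_ [a [b ->] <-]].
by rewrite setTI; apply: open_measurable_rV; apply: cf; exact: interval_open.
Qed.

Lemma open_bigcup_ball_rV (R : realType) (m : nat) (A : set 'rV[R]_m) :
  open A ->
  A = \bigcup_(q : 'rV[rat]_m * nat)
        (if `[< ball (map_mx ratr q.1 : 'rV[R]_m) q.2.+1%:R^-1 `<=` A >]
         then ball (map_mx ratr q.1 : 'rV[R]_m) q.2.+1%:R^-1 else set0).
Proof.
move=> oA; rewrite eqEsubset; split=> [x Ax|x [q _]]; last first.
  by case: asboolP => // + qx; exact.
have /nbhs_ballP[e /= e0 eA] : nbhs x A by exact: open_nbhs_nbhs.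
have [k k0 ke] : exists2 k : nat, true & k.+1%:R^-1 < e / 2.
  have e20 : 0 < e / 2 by rewrite divr_gt0.
  exists (Num.truncn (e / 2)^-1) => //; rewrite invf_plt ?posrE//.
  exact: truncnS_gt.
have kq (i : 'I_m) : exists q : rat,
    x ord0 i - k.+1%:R^-1 < ratr q < x ord0 i + k.+1%:R^-1.
  have : x ord0 i - k.+1%:R^-1 < x ord0 i + k.+1%:R^-1.
    by rewrite ltrBlDr -addrA ltrDl addr_gt0 ?invr_gt0.
  by move=> /rat_in_itvoo[q]; rewrite in_itv; exists q.
pose q := \row_i (sval (cid (kq i))).
have qx i j : `|map_mx ratr q i j - x i j| < k.+1%:R^-1 :> R.
  rewrite (ord1 i) !mxE; case: cid => r /= /andP[r1 r2].
  by rewrite ltr_distl r1 r2.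
have kk : 0 < k.+1%:R^-1 :> R by rewrite invr_gt0.
exists (q, k) => //=; rewrite asboolT; first by split => // i j; exact: qx.
move=> y [_ qy]; apply: eA; split => // i j.
rewrite /ball /= -(subrK (map_mx ratr q i j) (x i j)) -addrA.
rewrite (le_lt_trans (ler_normD _ _))// (splitr e) ltrD//.
  by rewrite distrC (lt_trans (qx i j)).
by rewrite (lt_trans (qy i j)).
Qed.

Section rV_cons.
Context (R : realType) (n : nat).

Definition rV_cons (p : measurableTypeR R * 'rV[R]_n) : 'rV[R]_n.+1 :=
  row_mx (p.1%:M : 'rV_1) p.2.

Definition rV_uncons (x : 'rV[R]_n.+1) : measurableTypeR R * 'rV[R]_n :=
  (x ord0 ord0, @rsubmx R 1 1 n x).

Lemma rV_cons0 (p : measurableTypeR R * 'rV[R]_n) :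
  rV_cons p ord0 ord0 = p.1.
Proof.
by rewrite mxE; case: splitP => j //= _; rewrite (ord1 j) mxE eqxx mulr1n.
Qed.

Lemma rV_consS (p : measurableTypeR R * 'rV[R]_n) (j : 'I_n) :
  rV_cons p ord0 (@rshift 1 n j) = p.2 ord0 j.
Proof. exact: row_mxEr. Qed.

Lemma rV_consK : cancel rV_cons rV_uncons.
Proof.
by case=> a x; congr pair; [exact: rV_cons0|exact: row_mxKr].
Qed.

Lemma rV_unconsK : cancel rV_uncons rV_cons.
Proof.
move=> x; apply/rowP => i; rewrite -(@splitK 1 n i).
case: (@fintype.split 1 n i) => k /=; last by rewrite rV_consS mxE.
rewrite (_ : @lshift 1 n k = @ord0 n) ?rV_cons0//.
by apply: val_inj; rewrite /= (ord1 k).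
Qed.

Lemma measurable_rV_cons : measurable_fun setT rV_cons.
Proof.
apply: measurable_fun_rV => A /open_bigcup_ball_rV ->.
rewrite preimage_bigcup; apply: countable_bigcupT_measurable => // -[q k].
case: ifPn => _ /=; last by rewrite preimage_set0.
set c := map_mx _ _; set e := _^-1; have e0 : 0 < e by rewrite invr_gt0.
rewrite (_ : _ @^-1` _ = ball (c ord0 ord0) e `*` ball (@rsubmx R 1 1 n c) e).
  apply: measurableX; first exact: (open_measurable (@ball_open _ R^o (c ord0 ord0) e)).
  exact: (open_measurable_rV (ball_open (@rsubmx R 1 1 n c) e)).
rewrite eqEsubset; split => -[a x]/=.
  move=> [_ cx]; split.
    by have := cx ord0 ord0; rewrite rV_cons0.
  split=> // i j; rewrite (ord1 i) mxE.
  by have := cx ord0 (@rshift 1 n j); rewrite rV_consS.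
move=> [ca [_ cx]]; split=> // i j; rewrite (ord1 i).
rewrite -(@splitK 1 n j); case: (@fintype.split 1 n j) => k'.
  rewrite (_ : @unsplit 1 n _ = @ord0 n) ?rV_cons0//.
  by apply: val_inj; rewrite /= (ord1 k').
by rewrite /= rV_consS; have := cx ord0 k'; rewrite mxE.
Qed.

Lemma measurable_rV_uncons : measurable_fun setT rV_uncons.
Proof.
apply/measurable_fun_pairP; split => /=.
  by apply: continuous_measurable_rVR; exact: coord_continuous.
apply: continuous_measurable_rV => x A /nbhs_ballP[e /= e0 eA].
apply/nbhs_ballP; exists e => //= y [_ xy]; apply: eA; split => // i j.
by rewrite !mxE; exact: xy.
Qed.

End rV_cons.

(* Lebesgue measure on R^n: the n-fold product of the one-dimensional one. *)
Section lebesgue_rV_succ.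
Local Open Scope ereal_scope.
Context (R : realType) (n : nat).
Variable mu : {sigma_finite_measure set 'rV[R]_n -> \bar R}.

Let nu :
    {measure set (measurableTypeR R * 'rV[R]_n)%type -> \bar R} :=
  @lebesgue_measure R \x mu.

Definition lebesgue_rV_succ : set 'rV[R]_n.+1 -> \bar R :=
  pushforward (@lebesgue_measure R \x mu) (@rV_cons R n).

Let preimage_measurable (A : set 'rV[R]_n.+1) :
  measurable A -> measurable (@rV_cons R n @^-1` A).
Proof.
by move=> mA; rewrite -[X in measurable X]setTI; exact: measurable_rV_cons.
Qed.

Let lebesgue_rV_succ0 : lebesgue_rV_succ set0 = 0.
Proof. by rewrite /lebesgue_rV_succ /pushforward preimage_set0 measure0. Qed.

Let lebesgue_rV_succ_ge0 A : 0 <= lebesgue_rV_succ A.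
Proof. exact: (measure_ge0 nu). Qed.

Let lebesgue_rV_succ_sigma_additive : semi_sigma_additive lebesgue_rV_succ.
Proof.
move=> F mF tF mUF; rewrite /lebesgue_rV_succ /pushforward preimage_bigcup.
apply: (@measure_semi_sigma_additive _ _ _ nu).
- by move=> k; apply: preimage_measurable; exact: mF.
- apply/trivIsetP => i j _ _ ij; rewrite -preimage_setI.
  by move/trivIsetP : tF => /(_ _ _ I I ij) ->; rewrite preimage_set0.
- by rewrite -preimage_bigcup; exact: preimage_measurable.
Qed.

HB.instance Definition _ := isMeasure.Build _ _ _ lebesgue_rV_succ
  lebesgue_rV_succ0 lebesgue_rV_succ_ge0 lebesgue_rV_succ_sigma_additive.

Let lebesgue_rV_succ_sigma_finite : sigma_finite setT lebesgue_rV_succ.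
Proof.
have /sigma_finiteP[F [FT ndF Foo]] := sigma_finiteT (@lebesgue_measure R).
have /sigma_finiteP[G [GT ndG Goo]] := sigma_finiteT mu.
exists (fun k => @rV_uncons R n @^-1` (F k `*` G k)).
  rewrite -preimage_bigcup; apply/esym/seteqP; split => // x _.
  have : [set: measurableTypeR R] (rV_uncons x).1 by [].
  rewrite FT => -[i _ Fi].
  have : [set: 'rV[R]_n] (rV_uncons x).2 by [].
  rewrite GT => -[j _ Gj].
  exists (maxn i j) => //; split.
    by move: Fi; exact/subsetPset/ndF/leq_maxl.
  by move: Gj; exact/subsetPset/ndG/leq_maxr.
move=> k; have [mF Fk] := Foo k; have [mG Gk] := Goo k; split.
  rewrite -[X in measurable X]setTI; apply: measurable_rV_uncons => //.
  exact: measurableX.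
rewrite /lebesgue_rV_succ /pushforward -comp_preimage.
rewrite (_ : _ \o _ = id) ?preimage_id.
  by rewrite product_measure1E// lte_mul_pinfty// ge0_fin_numE.
by apply/funext => p /=; exact: rV_consK.
Qed.

HB.instance Definition _ := Measure_isSigmaFinite.Build _ _ _ lebesgue_rV_succ
  lebesgue_rV_succ_sigma_finite.

End lebesgue_rV_succ.

Fixpoint lebesgue_rV (R : realType) (n : nat) :
    {sigma_finite_measure set 'rV[R]_n -> \bar R} :=
  match n with
  | 0 => \d_(0 : 'rV[R]_0)
  | m.+1 => lebesgue_rV_succ (lebesgue_rV R m)
  end.

Lemma lebesgue_rV_box (R : realType) (n : nat) (a b : 'rV[R]_n) :
  (forall i, a ord0 i <= b ord0 i) ->
  lebesgue_rV R n [set x | forall i, a ord0 i < x ord0 i <= b ord0 i] =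
  (\prod_(i < n) (b ord0 i - a ord0 i))%:E.
Proof.
elim: n a b => [|n IH] a b ab.
  by rewrite big_ord0 /= diracE mem_set// => -[].
have lift_rshift (j : 'I_n) : @rshift 1 n j = lift ord0 j.
  by apply: val_inj; rewrite /= /bump.
pose a' := @rsubmx R 1 1 n a; pose b' := @rsubmx R 1 1 n b.
pose B : set 'rV[R]_n := [set x | forall i, a' ord0 i < x ord0 i <= b' ord0 i].
have mB : measurable B.
  rewrite (_ : B = \bigcap_(i in [set: 'I_n])
      ((fun x : 'rV[R]_n => x ord0 i) @^-1` `]a' ord0 i, b' ord0 i]%classic)); last first.
    by apply/seteqP; split=> x /= H i *; have := H i; rewrite /= in_itv/=; apply.
  apply: fin_bigcap_measurable => // i _; rewrite -[X in measurable X]setTI.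
  by apply: continuous_measurable_rVR => //; exact: coord_continuous.
rewrite /= /lebesgue_rV_succ /pushforward.
rewrite (_ : _ @^-1` _ = `]a ord0 ord0, b ord0 ord0]%classic `*` B).
  rewrite product_measure1E//= IH; last by move=> i; rewrite !mxE.
  rewrite lebesgue_measure_itv/= lte_fin big_ord_recl/= EFinM.
  congr (_ * _)%E.
    have := ab ord0; rewrite le_eqVlt => /predU1P[->|->//].
    by rewrite ltxx subrr.
  by congr EFin; apply: eq_bigr => i _; rewrite !mxE lift_rshift.
apply/seteqP; split=> -[t x] /=.
  move=> H; split; first by have := H ord0; rewrite rV_cons0 in_itv.
  by move=> i; have := H (@rshift 1 n i); rewrite rV_consS !mxE.
rewrite in_itv/= => -[ht hx] i; have [j ->|->] := unliftP ord0 i.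
  by rewrite -lift_rshift rV_consS; have := hx j; rewrite !mxE lift_rshift.
by rewrite rV_cons0.
Qed.

Section levy.
Local Open Scope ereal_scope.
Context (R : realType) (n : nat).
Implicit Types (nu : set 'rV[R]_n -> \bar R) (u : 'rV[R]_n -> R).

(* The square of the Euclidean norm; `|x| on 'rV[R]_n is the sup norm. *)
Definition euclid_sqr (x : 'rV[R]_n) : R := (\sum_(i < n) x ord0 i ^+ 2)%R.

Definition symmetric_levy_measure nu : Prop :=
  [/\ nu [set 0%R] = 0,
      forall A : set 'rV[R]_n,
        measurable A -> nu [set (- a)%R | a in A] = nu A
    & \int[nu]_y (Num.min 1 (euclid_sqr y))%:E < +oo].

Definition translate nu (x : 'rV[R]_n) : set 'rV[R]_n -> \bar R :=
  fun A => nu [set (a - x)%R | a in A].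

Lemma translateE nu x : translate nu x = pushforward nu (fun z => (z + x)%R).
Proof.
apply/funext => A; rewrite /translate /pushforward; congr (nu _).
apply/seteqP; split => [_ [a Aa <-]|z Az] /=; first by rewrite subrK.
by exists (z + x)%R => //; rewrite addrK.
Qed.

Definition L2_sqr (Omega : set 'rV[R]_n) u : \bar R :=
  \int[lebesgue_rV R n]_(x in Omega) (u x ^+ 2)%:E.

Definition levy_energy_on (Omega : set 'rV[R]_n) nu u : \bar R :=
  (2^-1)%:E * \int[lebesgue_rV R n]_(y in Omega)
    \int[translate nu y]_x ((u x - u y) ^+ 2)%:E.

(* The quadratic form <u, u>_nu. *)
Definition levy_energy nu u : \bar R := levy_energy_on setT nu u.

(* H_nu^Omega(R^n), with a.e. classes given by their Borel representatives. *)
Definition levy_space nu (Omega : set 'rV[R]_n) : set ('rV[R]_n -> R) :=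
  [set u : 'rV[R]_n -> R | [/\ measurable_fun setT u,
               {ae lebesgue_rV R n, forall x, (~` Omega) x -> u x = 0%R}
             & L2_sqr Omega u + levy_energy_on Omega nu u < +oo]].

End levy.

(* Main.v *)
Require Import Defs.
From mathcomp Require Import all_boot all_order all_algebra.
From mathcomp Require Import all_classical all_reals all_analysis.
From mathcomp Require Import measurable_realfun ring.

Import Order.TTheory GRing.Theory Num.Theory.
Import numFieldNormedType.Exports.

(** Write [E(y)] for the integral over [x] of [(u (x + y) - u x) ^ 2], so that
[2 <u, u>_nu] is the integral of [E] against [nu]. The inequality follows from
an argument of Poincare type along long jumps, without Fourier transform.

Lebesgue measure is translation invariant, so [(a + b)^2 <= 2 a^2 + 2 b^2] gives
[E(y + y) <= 4 E(y)], and hence [E(2^k y) <= 4^k E(y)]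
([shift_energy_pow2]). If translation by [z] moves [Omega] off itself, then for
[x] in [Omega] the value [u (x + z)] is one of those that vanish almost
everywhere, and the same elementary inequality gives [||u||^2 <= 2 E(z)]
([L2_sqr_le_shift_energy]).

Since [nu] is nonzero and has no mass at the origin, it charges some set [K] of
vectors bounded away from the origin ([levy_large_jumps_gt0]), and the Levy
condition makes [nu K] finite ([levy_large_jumps_lty]). As [Omega] is bounded,
one [k] works for all of [K]: translation by [2^k y] moves [Omega] off itself
for every [y] in [K] ([large_jumps_escape]). Therefore
[||u||^2 <= 2 * 4^k * E(y)] on [K], and integrating over [K] against [nu]
([le_levy_energy], by Tonelli) gives [||u||^2 <= 4 * 4^k / nu K * <u, u>_nu]. *)

Local Open Scope classical_set_scope.
Local Open Scope ring_scope.

(** * Measurability of vector-valued maps *)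

Lemma measurable_rV_coord {R : realType} {n : nat} (i : 'I_n) :
  measurable_fun [set: 'rV[R]_n] (fun x : 'rV[R]_n => x ord0 i).
Proof. by apply: continuous_measurable_rVR; exact: coord_continuous. Qed.

(** The Borel sigma-algebra is generated by countably many sup-norm balls, and
such a ball is a finite intersection of conditions on single coordinates. *)
Lemma measurable_fun_rV_coords {d} {T : measurableType d} {R : realType}
    {n : nat} (f : T -> 'rV[R]_n) :
  (forall i, measurable_fun setT (fun t => f t ord0 i)) -> measurable_fun setT f.
Proof.
move=> mf; apply: measurable_fun_rV => A /open_bigcup_ball_rV ->.
rewrite preimage_bigcup; apply: countable_bigcupT_measurable => // -[q k].
case: ifPn => _ /=; last by rewrite preimage_set0.
set c := map_mx _ _; set e := _^-1.
have e0 : 0 < e by rewrite invr_gt0.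
rewrite (_ : _ @^-1` _ =
    \bigcap_(i in [set: 'I_n]) ((fun t => f t ord0 i) @^-1` ball (c ord0 i) e)).
  apply: fin_bigcap_measurable => // i _.
  rewrite -[X in measurable X]setTI; apply: mf => //.
  exact: (open_measurable (@ball_open _ R^o (c ord0 i) e)).
apply/seteqP; split => t /=; first by move=> [_ cf] i _; exact: cf.
move=> cf; split => // i j; rewrite (ord1 i); exact: cf.
Qed.

(** Continuity of addition is of no direct use here: the domain carries the
product of the two Borel sigma-algebras, so the proof goes by coordinates. *)
Lemma measurable_rVD {R : realType} {n : nat} :
  measurable_fun setT (fun p : 'rV[R]_n * 'rV[R]_n => p.1 + p.2).
Proof.
apply: measurable_fun_rV_coords => i.
rewrite (_ : (fun _ => _) =
    (fun p : 'rV[R]_n * 'rV[R]_n => p.1 ord0 i + p.2 ord0 i)); last first.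
  by apply/funext => p; rewrite mxE.
apply: measurable_funD.
  exact: (measurableT_comp (measurable_rV_coord i) measurable_fst).
exact: (measurableT_comp (measurable_rV_coord i) measurable_snd).
Qed.

Lemma measurable_rV_shift {R : realType} {n : nat} (h : 'rV[R]_n) :
  measurable_fun setT (fun x : 'rV[R]_n => x + h).
Proof.
apply: measurable_fun_rV_coords => i.
rewrite (_ : (fun _ => _) = (fun x : 'rV[R]_n => x ord0 i + h ord0 i)).
  by apply: measurable_funD => //; exact: measurable_rV_coord.
by apply/funext => p; rewrite mxE.
Qed.

(** * Translation invariance of Lebesgue measure *)

Section translation_invariance.
Local Open Scope ereal_scope.

Lemma lebesgue_measure_shift {R : realType} (h : R) (A : set R) :
  measurable A ->
  pushforward (@lebesgue_measure R)
    ((fun x : measurableTypeR R => (x + h)%R) : _ -> measurableTypeR R) A =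
  lebesgue_measure A.
Proof.
move=> mA.
have mh : measurable_fun setT
    ((fun x : measurableTypeR R => (x + h)%R) : _ -> measurableTypeR R).
  exact: measurable_funD.
apply/esym/lebesgue_measure_unique => //= _ [[a b]] _ <-.
rewrite /= /pushforward.
rewrite (_ : _ @^-1` _ = `]a - h, b - h]%classic)%R; last first.
  by apply/seteqP; split => x /=; rewrite !in_itv/= ltrBlDr lerBrDr.
rewrite !lebesgue_measure_itv/= !lte_fin ltrD2r -!EFinB opprB.
by rewrite addrA subrK.
Qed.

Lemma ge0_integral_lebesgue_shift {R : realType} (h : R) (f : R -> \bar R) :
  measurable_fun setT f -> (forall x, 0 <= f x) ->
  \int[@lebesgue_measure R]_x f (x + h)%R = \int[@lebesgue_measure R]_x f x.
Proof.
move=> mf f0.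
pose shift_h : measurableTypeR R -> measurableTypeR R := fun x => (x + h)%R.
have mh : measurable_fun setT shift_h by exact: measurable_funD.
rewrite [RHS](eq_measure_integral (pushforward lebesgue_measure shift_h)).
  by rewrite ge0_integral_pushforward.
by move=> A mA _; exact/esym/lebesgue_measure_shift.
Qed.

Lemma rV_consD {R : realType} {n : nat} (p q : measurableTypeR R * 'rV[R]_n) :
  (rV_cons p + rV_cons q)%R = rV_cons ((p.1 + q.1)%R, (p.2 + q.2)%R).
Proof.
rewrite /rV_cons raddfD /=; etransitivity; last first.
  exact: (@add_row_mx R 1 1 n p.1%:M p.2 q.1%:M q.2).
by [].
Qed.

(** Tonelli's theorem on the product measure that defines Lebesgue measure in
the next dimension. *)
Lemma ge0_integral_lebesgue_rV_succ {R : realType} {n : nat}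
    (f : 'rV[R]_n.+1 -> \bar R) :
  measurable_fun setT f -> (forall x, 0 <= f x) ->
  \int[lebesgue_rV R n.+1]_x f x =
  \int[@lebesgue_measure R]_r
    fubini_F (lebesgue_rV R n) (f \o @rV_cons R n) r.
Proof.
move=> mf f0; rewrite /= /lebesgue_rV_succ.
rewrite ge0_integral_pushforward//; last exact: measurable_rV_cons.
rewrite preimage_setT fubini_tonelli1//; last by move=> x; exact: f0.
exact: measurableT_comp mf (@measurable_rV_cons R n).
Qed.

(** By induction on the dimension: the induction hypothesis translates the tail
inside the iterated integral, the one-dimensional case translates the head
outside. *)
Lemma ge0_integral_lebesgue_rV_shift {R : realType} {n : nat} (h : 'rV[R]_n)
    (f : 'rV[R]_n -> \bar R) :
  measurable_fun setT f -> (forall x, 0 <= f x) ->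
  \int[lebesgue_rV R n]_x f (x + h)%R = \int[lebesgue_rV R n]_x f x.
Proof.
elim: n h f => [|n IH] h f mf f0.
  by apply: eq_integral => x _; rewrite (thinmx0 h) addr0.
have mfh := measurableT_comp mf (measurable_rV_shift h).
have mfc := measurableT_comp mf (@measurable_rV_cons R n).
rewrite !ge0_integral_lebesgue_rV_succ//.
rewrite -[RHS](@ge0_integral_lebesgue_shift _ (h ord0 ord0))//; last 2 first.
- by apply: measurable_fun_fubini_tonelli_F => // x; exact: f0.
- by move=> x; apply: integral_ge0 => y _; exact: f0.
apply: eq_integral => r _; rewrite /fubini_F /=.
rewrite -[RHS](IH (rV_uncons h).2)//.
  by apply: eq_integral => x _; rewrite -[in LHS](rV_unconsK h) rV_consD.
exact: measurableT_comp mfc (pair1_measurable _).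
Qed.

End translation_invariance.

(** * Energy of a single translation *)

Section poincare.
Set Implicit Arguments.
Unset Strict Implicit.
Local Open Scope ereal_scope.
Context {R : realType} {n : nat}.
Implicit Types (u : 'rV[R]_n -> R) (y : 'rV[R]_n) (Omega K : set 'rV[R]_n).

Local Notation lambda := (lebesgue_rV R n).

Definition shift_energy u y : \bar R :=
  \int[lambda]_x ((u (x + y) - u x) ^+ 2)%:E.

Lemma shift_energy_ge0 u y : 0 <= shift_energy u y.
Proof. by apply: integral_ge0 => x _; rewrite lee_fin sqr_ge0. Qed.

Lemma measurable_sqr_increment u : measurable_fun setT u ->
  measurable_fun setT
    (fun p : 'rV[R]_n * 'rV[R]_n => ((u (p.1 + p.2) - u p.1) ^+ 2)%:E).
Proof.
move=> mu; apply/measurable_EFinP; apply: measurable_funX.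
apply: measurable_funB; first exact: measurableT_comp mu measurable_rVD.
exact: measurableT_comp mu measurable_fst.
Qed.

Lemma measurable_sqr_increment1 u y : measurable_fun setT u ->
  measurable_fun setT (fun x : 'rV[R]_n => ((u (x + y) - u x) ^+ 2)%:E).
Proof.
by move=> mu; exact: (measurableT_comp (measurable_sqr_increment mu) (pair2_measurable y)).
Qed.

Lemma measurable_sqr_increment2 u x : measurable_fun setT u ->
  measurable_fun setT (fun y : 'rV[R]_n => ((u (x + y) - u x) ^+ 2)%:E).
Proof.
by move=> mu; exact: (measurableT_comp (measurable_sqr_increment mu) (pair1_measurable x)).
Qed.

(** Pass from [x] to [x + y + y] through [x + y]; by translation invariance both
steps cost [shift_energy u y]. *)
Lemma shift_energy_add_self u y : measurable_fun setT u ->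
  shift_energy u (y + y) <= 4%:E * shift_energy u y.
Proof.
move=> mu; have m1 := measurable_sqr_increment1 y mu.
have m2 := measurableT_comp m1 (measurable_rV_shift y).
pose f x := ((u (x + y) - u x) ^+ 2)%:E.
have f0 x : 0 <= f x by rewrite lee_fin sqr_ge0.
have -> : 4%:E * shift_energy u y =
    \int[lambda]_x (2%:E * f (x + y)%R + 2%:E * f x).
  rewrite ge0_integralD//; last 4 first.
  - by move=> x _; rewrite mule_ge0.
  - exact: (measurable_funeM _ m2).
  - by move=> x _; rewrite mule_ge0.
  - exact: (measurable_funeM _ m1).
  rewrite !ge0_integralZl//; last first.
  rewrite (ge0_integral_lebesgue_rV_shift y)// -ge0_muleDl//.
  by rewrite -EFinD -natrD.
apply: ge0_le_integral => //.
- by move=> x _; rewrite lee_fin sqr_ge0.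
- exact: measurable_sqr_increment1.
- by apply: emeasurable_funD; exact: measurable_funeM.
move=> x _; rewrite /f -!EFinM -EFinD lee_fin addrA.
set a := u _; set b := u _; set c := u _.
rewrite -subr_ge0 (_ : _ - _ = (a - c - (c - b)) ^+ 2)%R ?sqr_ge0//.
ring.
Qed.

Lemma shift_energy_pow2 u y k : measurable_fun setT u ->
  shift_energy u (y *+ 2 ^ k) <= (4 ^+ k)%:E * shift_energy u y.
Proof.
move=> mu; elim: k => [|k IH]; first by rewrite mulr1n mul1e.
rewrite expnS mul2n -addnn mulrnDr.
apply: (le_trans (shift_energy_add_self _ mu)).
by rewrite exprS EFinM -muleA lee_pmul2l.
Qed.

(** For [x] in [Omega], [u x ^ 2] is at most twice the squared increment plus
twice [u (x + y) ^ 2]. The last term is bounded by the translate of [u ^ 2]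
restricted to the complement of [Omega], whose integral vanishes; thus the
exceptional null set never has to be translated. *)
Lemma L2_sqr_le_shift_energy Omega u y :
  measurable Omega -> measurable_fun setT u ->
  {ae lambda, forall x, (~` Omega) x -> u x = 0%R} ->
  (forall x, Omega x -> ~ Omega (x + y)%R) ->
  L2_sqr Omega u <= 2%:E * shift_energy u y.
Proof.
move=> mO mu u0 Oy; have m1 := measurable_sqr_increment1 y mu.
have mu2 : measurable_fun setT (fun x => (u x ^+ 2)%:E).
  by apply/measurable_EFinP; exact: measurable_funX.
pose v := (fun x => (u x ^+ 2)%:E) \_ (~` Omega).
have v0 x : 0 <= v x.
  by rewrite /v patchE; case: ifPn => // _; rewrite lee_fin sqr_ge0.
have mv : measurable_fun setT v.
  apply/(measurable_restrictT _ _).1; first exact: measurableC.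
  exact: measurable_funTS.
have mvy := measurableT_comp mv (measurable_rV_shift y).
have iv : \int[lambda]_x v (x + y)%R = 0.
  rewrite ge0_integral_lebesgue_rV_shift// -integral_mkcond.
  rewrite -(integral0 lambda (~` Omega)).
  apply: ae_eq_integral => //.
  - exact: measurableC.
  - exact: measurable_funTS.
  - by apply: filterS u0 => x /= ux /ux ->; rewrite expr0n.
pose f x := ((u (x + y) - u x) ^+ 2)%:E.
have f0 x : 0 <= f x by rewrite lee_fin sqr_ge0.
have -> : 2%:E * shift_energy u y =
    \int[lambda]_x (2%:E * f x + 2%:E * v (x + y)%R).
  rewrite ge0_integralD//; last 4 first.
  - by move=> x _; rewrite mule_ge0.
  - exact: (measurable_funeM _ m1).
  - by move=> x _; rewrite mule_ge0.
  - exact: (measurable_funeM _ mvy).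
  by rewrite !ge0_integralZl// iv mule0 adde0.
have mg : measurable_fun setT (fun x => 2%:E * f x + 2%:E * v (x + y)%R).
  by apply: emeasurable_funD; exact: measurable_funeM.
have g0 x : 0 <= 2%:E * f x + 2%:E * v (x + y)%R.
  by rewrite adde_ge0// mule_ge0.
apply: (@le_trans _ _ (\int[lambda]_(x in Omega)
    (2%:E * f x + 2%:E * v (x + y)%R))); last first.
  by apply: ge0_subset_integral.
apply: ge0_le_integral => //.
- by move=> x _; rewrite lee_fin sqr_ge0.
- exact: measurable_funTS.
- exact: measurable_funTS.
move=> x /Oy Oxy; rewrite /f /v patchE mem_set//.
rewrite -!EFinM -EFinD lee_fin.
set a := u _; set b := u _.
rewrite -subr_ge0 (_ : _ - _ = (2 * b - a) ^+ 2)%R ?sqr_ge0//.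
ring.
Qed.

(** The integral of a nonnegative function is a supremum over the simple
functions below it, which is monotone whether or not the functions are
measurable. This allows comparing with the iterated integral against [nu],
whose inner integral would need sigma-finiteness of [nu] to be measurable. *)
Lemma ge0_le_integral_pointwise {d} {T : measurableType d}
    (mu : {measure set T -> \bar R}) (f g : T -> \bar R) :
  (forall x, 0 <= f x) -> (forall x, f x <= g x) ->
  \int[mu]_x f x <= \int[mu]_x g x.
Proof.
move=> f0 fg; rewrite !ge0_integralTE//; last first.
  by move=> x; exact: le_trans (f0 x) (fg x).
apply: ereal_sup_le => _ [h hf <-]; exists h => //= x.
exact: le_trans (hf x) (fg x).
Qed.

(** Discarding the jumps outside [K] replaces [nu] by a finite measure, to which
Tonelli's theorem applies: the energy is at least half the integral of
[shift_energy u] over [K]. *)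
Lemma le_levy_energy (nu : {measure set 'rV[R]_n -> \bar R}) K u (c : \bar R) :
  measurable K -> nu K < +oo -> measurable_fun setT u -> 0 <= c ->
  (forall y, K y -> c <= shift_energy u y) ->
  (2^-1)%:E * (c * nu K) <= levy_energy nu u.
Proof.
move=> mK nuKoo mu c0 cE.
pose nuK : {sigma_finite_measure set 'rV[R]_n -> \bar R} := mfrestr mK nuKoo.
rewrite /levy_energy /levy_energy_on lee_pmul2l//.
have restr (f : 'rV[R]_n -> \bar R) : \int[nu]_(y in K) f y = \int[nuK]_(y in K) f y.
  by apply: eq_measure_integral => A mA AK; rewrite /= /mfrestr /mrestr setIidl.
apply: (@le_trans _ _ (\int[nuK]_y shift_energy u y)).
  have mE : measurable_fun setT (shift_energy u).
    apply: (@measurable_fun_fubini_tonelli_G _ _ _ _ _ lambda _ (measurable_sqr_increment mu)).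
    by move=> x; rewrite lee_fin sqr_ge0.
  apply: (@le_trans _ _ (\int[nuK]_(y in K) shift_energy u y)); last first.
    by apply: ge0_subset_integral => // x _; exact: shift_energy_ge0.
  rewrite -restr -integral_cst//; apply: ge0_le_integral => //.
  exact: measurable_funTS.
have sq0 p : 0 <= ((u (p.1 + p.2) - u p.1) ^+ 2)%:E by rewrite lee_fin sqr_ge0.
rewrite [leLHS](_ : _ = \int[lambda]_x \int[nuK]_y ((u (x + y) - u x) ^+ 2)%:E); last first.
  exact/esym/(@fubini_tonelli _ _ _ _ _ lambda nuK _ (measurable_sqr_increment mu) sq0).
apply: ge0_le_integral_pointwise => x.
  by apply: integral_ge0 => y _; rewrite lee_fin sqr_ge0.
have mx := measurable_sqr_increment2 x mu.
rewrite translateE ge0_integral_pushforward//; last 3 first.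
- exact: measurable_rV_shift.
- apply/measurable_EFinP; apply: measurable_funX; exact: measurable_funB.
- by move=> z _; rewrite lee_fin sqr_ge0.
rewrite preimage_setT (@ge0_negligible_integral _ _ _ nuK _ (~` K))//; last 3 first.
- exact: measurableC.
- by move=> y _; rewrite lee_fin sqr_ge0.
- by rewrite /nuK /= /mfrestr /mrestr setICl measure0.
rewrite setTD setCK -restr.
under [leRHS]eq_integral => y _ do rewrite /= (addrC y).
apply: ge0_subset_integral => //.
by move=> y _; rewrite lee_fin sqr_ge0.
Qed.

End poincare.

(** * Large jumps of a Levy measure *)

Section levy_large_jumps.
Context {R : realType} {n : nat}.
Implicit Types (x y : 'rV[R]_n).

(** The threshold is on the squared Euclidean norm, the quantity that the Levy
condition controls. *)
Definition large_jumps (e : R) : set 'rV[R]_n := [set y | e <= euclid_sqr y].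

Lemma measurable_euclid_sqr : measurable_fun setT (@euclid_sqr R n).
Proof.
apply: measurable_sum => i; apply: measurable_funX; exact: measurable_rV_coord.
Qed.

Lemma measurable_large_jumps e : measurable (large_jumps e).
Proof.
rewrite (_ : large_jumps e = (@euclid_sqr R n) @^-1` `[e, +oo[); last first.
  by apply/seteqP; split => y; rewrite /large_jumps /= in_itv/= andbT.
by rewrite -[X in measurable X]setTI; apply: measurable_euclid_sqr => //; exact: measurable_itv.
Qed.

Lemma euclid_sqr_ge0 y : 0 <= euclid_sqr y.
Proof. by apply: sumr_ge0 => i _; exact: sqr_ge0. Qed.

Lemma euclid_sqr_gt0 y : y != 0 -> 0 < euclid_sqr y.
Proof.
move=> y0; rewrite lt_neqAle euclid_sqr_ge0 andbT eq_sym.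
apply: contra y0; rewrite psumr_eq0; last by move=> i _; exact: sqr_ge0.
move=> /allP yi; apply/eqP/rowP => i; rewrite mxE; apply/eqP.
by have := yi i (mem_index_enum i); rewrite sqrf_eq0.
Qed.

Lemma euclid_sqrMn y m : euclid_sqr (y *+ m) = m%:R ^+ 2 * euclid_sqr y.
Proof.
rewrite /euclid_sqr mulr_sumr; apply: eq_bigr => i _.
by rewrite mulmxnE -[_ *+ m]mulr_natl exprMn.
Qed.

(** Markov's inequality for the integrand of the Levy condition, which is at
least [min 1 e] on the large jumps. *)
Lemma levy_large_jumps_lty (nu : {measure set 'rV[R]_n -> \bar R}) e :
  symmetric_levy_measure nu -> 0 < e -> (nu (large_jumps e) < +oo)%E.
Proof.
move=> [_ _ nu_levy] e0; have mK := measurable_large_jumps e.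
have mf : measurable_fun setT (fun y : 'rV[R]_n => (Num.min 1 (euclid_sqr y))%:E).
  apply/measurable_EFinP; apply: measurable_minr => //.
  exact: measurable_euclid_sqr.
have f0 (y : 'rV[R]_n) : (0 <= (Num.min 1 (euclid_sqr y))%:E)%E.
  by rewrite lee_fin le_min ler01 euclid_sqr_ge0.
have m0 : 0 < Num.min 1 e by rewrite lt_min ltr01.
have : ((Num.min 1 e)%:E * nu (large_jumps e) < +oo)%E.
  apply: le_lt_trans nu_levy; rewrite -integral_cst//.
  apply: (@le_trans _ _
      (\int[nu]_(y in large_jumps e) (Num.min 1 (euclid_sqr y))%:E)%E).
    apply: ge0_le_integral => //.
    - by move=> y _; rewrite lee_fin ltW.
    - exact: measurable_funTS.
    - move=> y Ky; rewrite lee_fin le_min !ge_min lexx /=.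
      by rewrite (Ky : e <= euclid_sqr y) orbT.
  exact: ge0_subset_integral.
by case: (nu _) => [r| |] => //; rewrite ?ltry// gt0_muley// lte_fin.
Qed.

Lemma large_jumps_exhaust y : y != 0 -> exists j : nat, large_jumps j.+1%:R^-1 y.
Proof.
move=> /euclid_sqr_gt0 y0; exists (Num.truncn (euclid_sqr y)^-1).
rewrite /large_jumps /= invf_ple ?posrE//.
exact/ltW/truncnS_gt.
Qed.

Lemma measurable_rV_set0 : measurable [set (0 : 'rV[R]_n)].
Proof.
rewrite (_ : [set 0] = @euclid_sqr R n @^-1` [set 0]).
  by rewrite -[X in measurable X]setTI; apply: measurable_euclid_sqr.
apply/seteqP; split => [_ ->|y /= y0].
  by rewrite /= /euclid_sqr big1// => i _; rewrite mxE expr0n.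
by apply: contrapT => /eqP/euclid_sqr_gt0; rewrite y0 ltxx.
Qed.

(** Otherwise all the sets [large_jumps (1 / (j + 1))] are null; with the origin
they cover the whole space, and [nu] would be zero. *)
Lemma levy_large_jumps_gt0 (nu : {measure set 'rV[R]_n -> \bar R}) :
  nu [set 0] = 0%E -> (exists A, measurable A /\ nu A <> 0%E) ->
  exists2 e : R, 0 < e & (0 < nu (large_jumps e))%E.
Proof.
move=> nu0 [A [mA nuA]]; apply: contrapT => noe; apply: nuA.
have K0 (j : nat) : nu (large_jumps j.+1%:R^-1) = 0%E.
  apply/eqP; rewrite eq_le measure_ge0 andbT leNgt; apply/negP => nuj.
  by apply: noe; exists j.+1%:R^-1.
apply/negligibleP => //.
apply: (@negligibleS _ _ _ _ ([set 0] `|` \bigcup_j large_jumps j.+1%:R^-1)).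
  move=> y _; have [->|/large_jumps_exhaust[j Kj]] := eqVneq y 0; first by left.
  by right; exists j.
apply: negligibleU; first by exists [set 0]; split => //; exact: measurable_rV_set0.
apply: negligible_bigcup => j.
by exists (large_jumps j.+1%:R^-1); split => //; exact: measurable_large_jumps.
Qed.

Lemma bounded_euclid_sqr (A : set 'rV[R]_n) : bounded_set A ->
  exists D : R, forall x y, A x -> A y -> euclid_sqr (x - y) < D.
Proof.
move=> [M0 [_ M0A]]; pose M := M0 + 1.
have AM x : A x -> `|x| <= M by apply: M0A; rewrite ltrDl.
(* the summand 1 makes the bound strict, also when n = 0 *)
exists (n%:R * (M + M) ^+ 2 + 1) => x y Ax Ay.
rewrite ltr_pwDr// /euclid_sqr.
rewrite (_ : n%:R * _ = \sum_(i < n) (M + M) ^+ 2); last first.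
  by rewrite sumr_const card_ord mulr_natl.
apply: ler_sum => i _.
have le_coord (z : 'rV[R]_n) : `|z ord0 i| <= `|z|.
  rewrite [leRHS]/Num.norm /= mx_normrE.
  exact: (@le_bigmax _ _ _ 0 (fun ij => `|z ij.1 ij.2|) (ord0, i)).
rewrite -[leLHS]real_normK ?num_real//.
have xyM : `|(x - y) ord0 i| <= M + M.
  rewrite (le_trans (le_coord _))// (le_trans (ler_normB _ _))//.
  by rewrite lerD// AM.
by rewrite lerXn2r// ?nnegrE// (le_trans _ xyM).
Qed.

(** If both [x] and [x + 2^k y] lie in [A], then [4^k] times the squared norm of
[y] is below a bound depending on [A] only; [k] is chosen to rule this out. *)
Lemma large_jumps_escape (A : set 'rV[R]_n) (e : R) : bounded_set A -> 0 < e ->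
  exists k : nat, forall x y, large_jumps e y -> A x -> ~ A (x + y *+ 2 ^ k).
Proof.
move=> /bounded_euclid_sqr[D AD] e0; exists (Num.truncn (D / e)) => x y ey Ax Axy.
have := AD _ _ Axy Ax; rewrite addrAC subrr add0r euclid_sqrMn.
set k := Num.truncn _.
(* D / e < k + 1 <= 2 ^ k <= (2 ^ k) ^ 2 *)
have : D / e < (2 ^ k)%:R ^+ 2.
  apply: (lt_le_trans (truncnS_gt _)); rewrite -natrX ler_nat.
  by rewrite (leq_trans (ltn_expl k (ltnSn 1)))// -[leqLHS]expn1 leq_pexp2l// expn_gt0.
rewrite ltr_pdivrMr// => De; apply/negP; rewrite -leNgt.
by rewrite (le_trans (ltW De))// ler_wpM2l// sqr_ge0.
Qed.

End levy_large_jumps.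

Theorem theorem4p7 (R : realType) (n : nat) (Omega : set 'rV[R]_n)
    (Omega_nonempty : Omega !=set0) (Omega_bounded : bounded_set Omega)
    (Omega_open : open Omega)
    (nu : {measure set 'rV[R]_n -> \bar R})
    (nu_levy : symmetric_levy_measure nu)
    (nu_neq0 : exists A : set 'rV[R]_n, measurable A /\ nu A <> 0%E) :
  exists C : R, forall u : 'rV[R]_n -> R, levy_space nu Omega u ->
    (L2_sqr Omega u <= C%:E * levy_energy nu u)%E.
Proof.
have [nu0 _ _] := nu_levy.
have [e e0 nuK0] := levy_large_jumps_gt0 nu0 nu_neq0.
have nuKoo := levy_large_jumps_lty nu_levy e0.
have [k escape] := large_jumps_escape Omega_bounded e0.
set K := large_jumps e in nuK0 nuKoo escape.
pose a : R := 2 * 4 ^+ k.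
have a0 : 0 < a by rewrite mulr_gt0// exprn_gt0.
have nuKE : nu K = (fine (nu K))%:E by rewrite fineK// ge0_fin_numE// ltW.
have fK0 : 0 < fine (nu K) by rewrite -lte_fin -nuKE.
(* [b * ||u||^2 <= <u, u>_nu], where [a] relates [||u||^2] to the energy of one
   translation by a vector of [K] *)
pose b : R := 2^-1 * (a^-1 * fine (nu K)).
have b0 : 0 < b by rewrite !mulr_gt0// invr_gt0.
exists b^-1 => u [mu u0 _].
have L20 : (0 <= L2_sqr Omega u)%E.
  by apply: integral_ge0 => x _; rewrite lee_fin sqr_ge0.
have LE y : K y -> ((a^-1)%:E * L2_sqr Omega u <= shift_energy u y)%E.
  move=> Ky; rewrite lee_pdivrMl//.
  have mO := open_measurable_rV Omega_open.
  have Oy x : Omega x -> ~ Omega (x + y *+ 2 ^ k) by exact: escape.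
  apply: (le_trans (L2_sqr_le_shift_energy mO mu u0 Oy)).
  by rewrite EFinM -muleA lee_pmul2l// shift_energy_pow2.
have c0 : (0 <= (a^-1)%:E * L2_sqr Omega u)%E.
  by rewrite mule_ge0// lee_fin invr_ge0 ltW.
have := le_levy_energy (measurable_large_jumps e) nuKoo mu c0 LE.
rewrite -/K nuKE => energy_ge; rewrite lee_pdivlMl//; apply: le_trans energy_ge.
by rewrite /b !EFinM -!muleA [X in (_ * (_ * X))%E]muleC.
Qed.
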